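(* Let $\mathcal R$ be a nearly parallel $Spin(9)$-structure on a 16-dimensional oriented Riemannian manifold $(M^{16},g)$, and let $T^*$ be the torsion tensor of the connection $Z^*$. Then $$T^*(\mathcal JX,\mathcal JY)-\mathcal JT^*(\mathcal JX,Y)-\mathcal JT^*(X,\mathcal JY)-T^*(X,Y)=0$$ for every $x\in M^{16}$, every $\mathcal J\in\Lambda^2(V^9)_x$ with $\mathcal J^2=-\mathrm{Id}$, and all $X,Y\in T_xM^{16}$.
   Context: $Spin(9)\subset SO(16)$: $\mathbb R^{16}=\Delta_9$ is the real spin representation. It carries nine symmetric involutions $I_1,\dots,I_9$ with $I_\alpha^2=\mathrm{Id}$, $I_\alpha^*=I_\alpha$, $I_\alpha I_\beta=-I_\beta I_\alpha$ ($\alpha\ne\beta$), spanning a copy of $\mathbb R^9$ in the symmetric endomorphisms, and $Spin(9)$ is the group of all products of an even number of unit vectors of this $\mathbb R^9$. Its Lie algebra is $\mathfrak{spin}(9)=\mathrm{Lin}(I_\alpha I_\beta:\alpha<\beta)$ and its orthogonal complement in $\mathfrak{so}(16)$ is $\mathfrak m=\mathrm{Lin}(I_\alpha I_\beta I_\gamma:\alpha<\beta<\gamma)$, where $\mathrm{Lin}$ denotes the real linear span. A $Spin(9)$-structure on $(M^{16},g)$ is a reduction $\mathcal R$ of the $SO(16)$-frame bundle to $Spin(9)$; locally it gives sections $I_1,\dots,I_9$ of $\mathrm{End}(TM^{16})$ with $I_\alpha^2=\mathrm{Id}$, $I_\alpha^*=I_\alpha$, $I_\alpha I_\beta=-I_\beta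 I_\alpha$ ($\alpha\ne\beta$), spanning a rank 9 bundle $V^9$; $\Lambda^2(V^9)$ is regarded as the subbundle of $\mathrm{End}(TM^{16})$ spanned by the $I_\alpha I_\beta$, $\alpha<\beta$. Restrict the Levi-Civita connection form $Z$ to $\mathcal R$ and decompose $Z|_{\mathcal R}=Z^*\oplus\Gamma$ according to $\mathfrak{so}(16)=\mathfrak{spin}(9)\oplus\mathfrak m$; $Z^*$ is a connection in $\mathcal R$ (hence induces a metric connection on $TM^{16}$) and $\Gamma$ is a 1-form on $M^{16}$ with values in $\mathcal R\times_{Spin(9)}\mathfrak m\subset\mathrm{End}(TM^{16})$. The structure is nearly parallel if $\Gamma$ is a vector field, i.e. there is a vector field, also denoted $\Gamma$, such that the 1-form is $X\mapsto 6\sum_{\alpha<\beta<\gamma} g(I_\gamma I_\beta I_\alpha\Gamma, X)\, I_\alpha I_\beta I_\gamma$. *)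

(* Defs.v *)
(* MathComp-Analysis; the real numbers are an arbitrary R : realType. *)
From HB Require Import structures.
From mathcomp Require Import all_boot all_order all_algebra.
From mathcomp Require Import all_classical all_reals all_analysis.

Set Implicit Arguments.
Unset Strict Implicit.
Unset Printing Implicit Defensive.
Import Order.TTheory GRing.Theory Num.Theory numFieldNormedType.Exports.
Local Open Scope classical_set_scope.
Local Open Scope ring_scope.

(** * Smooth manifolds *)

(* For U open; continuity of f and of its lower derivatives is implied by
   continuity of the derivatives of highest order. *)
Fixpoint is_Ck (R : realType) (n k : nat) (U : set 'rV[R]_n)
    (f : 'rV[R]_n -> R) : Prop :=
  match k with
  | 0 => forall p, U p -> {for p, continuous f}
  | k'.+1 => forall i : 'I_n, (forall p, U p -> derivable f p (delta_mx 0 i)) /\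
               is_Ck k' U (fun p => 'D_(delta_mx 0 i) f p)
  end.

Definition is_Cinfty (R : realType) (n : nat) (U : set 'rV[R]_n)
  (f : 'rV[R]_n -> R) : Prop := forall k, is_Ck k U f.

(* A chart with domain cdom; only the values of cmap on cdom and of cinv on
   the image of cdom are meaningful. *)
Record chart (R : realType) (n : nat) (M : topologicalType) := Chart {
  cdom : set M;
  cmap : M -> 'rV[R]_n;
  cinv : 'rV[R]_n -> M;
  cdom_open : open cdom;
  cimg_open : open (cmap @` cdom);
  cmapK : forall x, cdom x -> cinv (cmap x) = x;
  cmap_continuous : forall x, cdom x -> {for x, continuous cmap};
  cinv_continuous : forall p, (cmap @` cdom) p -> {for p, continuous cinv}
}.

Record manifold (R : realType) (n : nat) := Manifold {
  carrier :> topologicalType;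
  atlas : set (chart R n carrier);
  manifold_hausdorff : hausdorff_space carrier;
  manifold_second_countable : @second_countable carrier;
  atlas_cover : forall x, exists2 c, atlas c & cdom c x;
  atlas_smooth : forall c c', atlas c -> atlas c' -> forall i : 'I_n,
    is_Cinfty (cmap c @` (cdom c `&` cdom c'))
      (fun p => cmap c' (cinv c p) 0 i)
}.

(* The orientation of an oriented manifold is the one defined by its atlas. *)
Definition oriented_atlas (R : realType) (n : nat) (M : manifold R n) : Prop :=
  forall c c' : chart R n M, atlas c -> atlas c' ->
  forall p, (cmap c @` (cdom c `&` cdom c')) p ->
    0 < \det ('J (cmap c' \o cinv c) p).

(** * Tangent spaces *)

Definition smooth_on (R : realType) (n : nat) (M : manifold R n) (U : set M)
    (f : M -> R) : Prop :=
  forall c : chart R n M, atlas c ->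
    is_Cinfty (cmap c @` (U `&` cdom c)) (f \o cinv c).

Definition smooth_at (R : realType) (n : nat) (M : manifold R n) (x : M)
    (f : M -> R) : Prop :=
  exists2 U, open_nbhs x U & smooth_on U f.

(* Derivations of the algebra of germs at x of smooth functions; the last
   clause normalizes the irrelevant values, so that equality of derivations is
   equality of functions. *)
Definition derivations (R : realType) (n : nat) (M : manifold R n) (x : M) :
    set ((M -> R) -> R^o) :=
  [set D | [/\ forall (a : R) (f g : M -> R), smooth_at x f -> smooth_at x g ->
                 D (fun y => a * f y + g y) = a * D f + D g,
               forall f g : M -> R, smooth_at x f -> smooth_at x g ->
                 D (fun y => f y * g y) = D f * g x + f x * D g,
               forall f g : M -> R, smooth_at x f -> smooth_at x g ->
                 (\forall y \near x, f y = g y) -> D f = D g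
             & forall f : M -> R, ~ smooth_at x f -> D f = 0]].

Definition is_derivation (R : realType) (n : nat) (M : manifold R n) (x : M) :
  {pred (M -> R) -> R^o} := mem (derivations x).

Record tangent (R : realType) (n : nat) (M : manifold R n) (x : M) := Tangent {
  tangent_fun :> (M -> R) -> R^o;
  tangent_proof : tangent_fun \in is_derivation x
}.

Lemma derivations_submod_closed (R : realType) (n : nat) (M : manifold R n)
  (x : M) : submod_closed (is_derivation x).
Proof.
split.
  rewrite inE /=; split=> //= *; rewrite -?[(0 : (M -> R) -> R^o) _]/(0 : R).
  - by rewrite mulr0 addr0.
  - by rewrite mul0r mulr0 addr0.
move=> a D E; rewrite !inE /= => -[D1 D2 D3 D4] [E1 E2 E3 E4].
have eval h : (a *: D + E) h = (a * D h + E h :> R) by [].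
split=> [b f g sf sg|f g sf sg|f g sf sg fg|f nsf]; rewrite !eval.
- rewrite D1// E1// !mulrDr !mulrA [a * b]mulrC.
  by rewrite addrACA.
- rewrite D2// E2// !mulrDr !mulrDl !mulrA [a * f x]mulrC.
  by rewrite addrACA.
- by rewrite (D3 f g)// (E3 f g).
- by rewrite D4// E4// mulr0 addr0.
Qed.

HB.instance Definition _ (R : realType) (n : nat) (M : manifold R n) (x : M) :=
  [isSub for @tangent_fun R n M x].
HB.instance Definition _ (R : realType) (n : nat) (M : manifold R n) (x : M) :=
  [Choice of tangent x by <:].
HB.instance Definition _ (R : realType) (n : nat) (M : manifold R n) (x : M) :=
  GRing.isSubmodClosed.Build R ((M -> R) -> R^o) (is_derivation x)
    (derivations_submod_closed x).
HB.instance Definition _ (R : realType) (n : nat) (M : manifold R n) (x : M) :=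
  [SubChoice_isSubLmodule of tangent x by <:].

(** * Vector fields, metrics and covariant derivatives *)

(* A vector field on an open set U is a total section, of which only the
   values on U matter. *)
Definition smooth_vf (R : realType) (n : nat) (M : manifold R n) (U : set M)
    (X : forall y : M, tangent y) : Prop :=
  forall (V : set M) (f : M -> R), open V -> V `<=` U -> smooth_on V f ->
    smooth_on V (fun y => X y f).

(* [X, Y]_x; the formula is a derivation at x, hence a tangent vector,
   whenever X and Y are smooth near x. *)
Definition lie_bracket (R : realType) (n : nat) (M : manifold R n)
    (X Y : forall y : M, tangent y) (x : M) : tangent x :=
  insubd (0 : tangent x) (fun f : M -> R =>
    if `[< smooth_at x f >] then X x (fun y => Y y f) - Y x (fun y => X y f)
    else 0).

Record metric (R : realType) (n : nat) (M : manifold R n) := Metric {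
  metric_fun :> forall x : M, tangent x -> tangent x -> R;
  metric_sym : forall x (u v : tangent x), metric_fun u v = metric_fun v u;
  metric_lin : forall x a (u v w : tangent x),
    metric_fun (a *: u + v) w = a * metric_fun u w + metric_fun v w;
  metric_pos : forall x (u : tangent x), u != 0 -> 0 < metric_fun u u;
  metric_smooth : forall (U : set M) X Y, open U ->
    smooth_vf U X -> smooth_vf U Y ->
    smooth_on U (fun y => metric_fun (X y) (Y y))
}.

(* Covariant derivatives on the tangent bundle; nabla x u Y is the derivative
   at x of Y in the direction u. *)
Record connection (R : realType) (n : nat) (M : manifold R n) := Connection {
  cov :> forall x : M, tangent x -> (forall y : M, tangent y) -> tangent x;
  cov_lin : forall (U : set M) x Y, open_nbhs x U -> smooth_vf U Y ->
    forall a (u v : tangent x), cov (a *: u + v) Y = a *: cov u Y + cov v Y;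
  cov_add : forall (U : set M) x Y Z, open_nbhs x U ->
    smooth_vf U Y -> smooth_vf U Z ->
    forall u : tangent x, cov u (fun y => Y y + Z y) = cov u Y + cov u Z;
  cov_leibniz : forall (U : set M) x f Y, open_nbhs x U ->
    smooth_on U f -> smooth_vf U Y ->
    forall u : tangent x,
      cov u (fun y => f y *: Y y) = u f *: Y x + f x *: cov u Y;
  cov_local : forall (U : set M) x Y Z, open_nbhs x U -> smooth_vf U Y ->
    (forall y, U y -> Y y = Z y) -> forall u : tangent x, cov u Y = cov u Z;
  cov_smooth : forall (U : set M) X Y, open U ->
    smooth_vf U X -> smooth_vf U Y -> smooth_vf U (fun y => cov (X y) Y)
}.

Definition torsion (R : realType) (n : nat) (M : manifold R n)
    (nabla : connection M) (X Y : forall y : M, tangent y) (x : M) :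
    tangent x :=
  nabla x (X x) Y - nabla x (Y x) X - lie_bracket X Y x.

(* Every tangent vector extends to a vector field smooth near x, so this
   determines T. *)
Definition is_torsion_tensor (R : realType) (n : nat) (M : manifold R n)
    (nabla : connection M)
    (T : forall x : M, tangent x -> tangent x -> tangent x) : Prop :=
  forall (U : set M) X Y x, open_nbhs x U -> smooth_vf U X -> smooth_vf U Y ->
    T x (X x) (Y x) = torsion nabla X Y x.

Definition is_levi_civita (R : realType) (n : nat) (M : manifold R n)
    (g : metric M) (nabla : connection M) : Prop :=
  (forall (U : set M) X Y x, open_nbhs x U -> smooth_vf U X -> smooth_vf U Y ->
     torsion nabla X Y x = 0) /\
  (forall (U : set M) X Y x (u : tangent x), open_nbhs x U ->
     smooth_vf U X -> smooth_vf U Y ->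
     u (fun y => g y (X y) (Y y)) =
     g x (nabla x u X) (Y x) + g x (X x) (nabla x u Y)).

(** * Frames *)

Definition frame (R : realType) (n : nat) (M : manifold R n) (x : M) :=
  'I_n -> tangent x.

Definition frame_map (R : realType) (n : nat) (M : manifold R n) (x : M)
    (e : frame x) (v : 'cV[R]_n) : tangent x := \sum_i v i 0 *: e i.

Definition orthonormal (R : realType) (n : nat) (M : manifold R n)
    (g : metric M) (x : M) (e : frame x) : Prop :=
  forall i j, g x (e i) (e j) = (i == j)%:R.

Definition positive_frame (R : realType) (n : nat) (M : manifold R n) (x : M)
    (e : frame x) : Prop :=
  forall c : chart R n M, atlas c -> cdom c x ->
    0 < \det (\matrix_(i, j) e j (fun y => cmap c y 0 i)).

Definition SO_frame (R : realType) (n : nat) (M : manifold R n) (g : metric M)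
    (x : M) (e : frame x) : Prop :=
  [/\ bijective (frame_map e), orthonormal g e & positive_frame e].

Definition frame_act (R : realType) (n : nat) (M : manifold R n) (x : M)
    (e : frame x) (A : 'M[R]_n) : frame x := fun j => \sum_i A i j *: e i.

(* The endomorphism e o A o e^-1 of the tangent space, for an orthonormal
   frame e. *)
Definition frame_endo (R : realType) (n : nat) (M : manifold R n) (g : metric M)
    (x : M) (e : frame x) (A : 'M[R]_n) (u : tangent x) : tangent x :=
  frame_map e (A *m \col_j g x u (e j)).

(* The value at u of the pull-back by the local section s of the connection
   form on the orthonormal frame bundle: nabla_u s_j = \sum_i Z i j *: s_i. *)
Definition connection_form (R : realType) (n : nat) (M : manifold R n)
    (g : metric M) (nabla : connection M) (s : forall y : M, frame y) (x : M)
    (u : tangent x) : 'M[R]_n :=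
  \matrix_(i, j) g x (nabla x u (fun y => s y j)) (s x i).

Definition local_section (R : realType) (n : nat) (M : manifold R n)
    (P : forall x : M, set (frame x)) (U : set M) (s : forall y : M, frame y) :
    Prop :=
  [/\ open U, forall j, smooth_vf U (fun y => s y j)
    & forall y, U y -> P y (s y)].

(** * Spin(9) *)

Definition spin9_involutions (R : realType) (I : 'I_9 -> 'M[R]_16) : Prop :=
  [/\ forall a, I a *m I a = 1%:M, forall a, (I a)^T = I a
    & forall a b, a != b -> I a *m I b = - (I b *m I a)].

Definition Spin9 (R : realType) (I : 'I_9 -> 'M[R]_16) : set 'M[R]_16 :=
  [set A | exists s : seq 'rV[R]_9,
     [/\ ~~ odd (size s), forall v, v \in s -> \sum_a v 0 a ^+ 2 = 1
       & A = \big[mulmx/1%:M]_(v <- s) (\sum_a v 0 a *: I a)]].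

Definition spin9_lie (R : realType) (I : 'I_9 -> 'M[R]_16) : set 'M[R]_16 :=
  [set A | exists c : 'I_9 -> 'I_9 -> R,
     A = \sum_(a : 'I_9) \sum_(b : 'I_9 | (a < b)%N) c a b *: (I a *m I b)].

Definition spin9_m (R : realType) (I : 'I_9 -> 'M[R]_16) : set 'M[R]_16 :=
  [set A | exists c : 'I_9 -> 'I_9 -> 'I_9 -> R,
     A = \sum_(a : 'I_9) \sum_(b : 'I_9 | (a < b)%N) \sum_(d : 'I_9 | (b < d)%N)
           c a b d *: (I a *m I b *m I d)].

(* Reductions to Spin(9) of the bundle of positively oriented orthonormal
   frames. *)
Record spin9_structure (R : realType) (M : manifold R 16) (g : metric M)
    (I : 'I_9 -> 'M[R]_16) := Spin9Structure {
  reduction :> forall x : M, set (frame x);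
  reduction_SO : forall x (e : frame x), reduction e -> SO_frame g e;
  reduction_orbit : forall x (e e' : frame x), reduction e ->
    (reduction e' <-> exists2 A, Spin9 I A & e' = frame_act e A);
  reduction_section : forall x, exists U s,
    open_nbhs x U /\ local_section reduction U s
}.

(* The restriction Z of the connection form of nabla to P decomposes as
   Zstar + Gamma with Zstar, the connection form of nabla_star, valued in
   spin(9) and Gamma valued in m.  Through the frames, Gamma is a 1-form on M
   with values in the endomorphisms of the tangent spaces. *)
Definition spin9_decomposition (R : realType) (M : manifold R 16) (g : metric M)
    (I : 'I_9 -> 'M[R]_16) (P : spin9_structure g I)
    (nabla nabla_star : connection M)
    (Gamma : forall x : M, tangent x -> tangent x -> tangent x) : Prop :=
  forall (U : set M) (s : forall y : M, frame y), local_section P U s ->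
  forall x (u : tangent x), U x ->
    spin9_lie I (connection_form g nabla_star s u) /\
    exists2 B, spin9_m I B &
      connection_form g nabla s u = connection_form g nabla_star s u + B /\
      Gamma x u = frame_endo g (s x) B.

Definition nearly_parallel (R : realType) (M : manifold R 16) (g : metric M)
    (I : 'I_9 -> 'M[R]_16) (P : spin9_structure g I)
    (Gamma : forall x : M, tangent x -> tangent x -> tangent x) : Prop :=
  exists2 G : forall x : M, tangent x, smooth_vf setT G &
    forall x (e : frame x), P x e -> forall X Y : tangent x,
      let Ie a := frame_endo g e (I a) in
      Gamma x X Y = 6%:R *:
        \sum_(a : 'I_9) \sum_(b : 'I_9 | (a < b)%N) \sum_(d : 'I_9 | (b < d)%N)
          g x (Ie d (Ie b (Ie a (G x)))) X *: Ie a (Ie b (Ie d Y)).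

(* The fibre at x of Lambda^2(V^9), as a set of endomorphisms. *)
Definition Lambda2V (R : realType) (M : manifold R 16) (g : metric M)
    (I : 'I_9 -> 'M[R]_16) (P : spin9_structure g I) (x : M) :
    set (tangent x -> tangent x) :=
  [set J | exists2 e : frame x, P x e & exists c : 'I_9 -> 'I_9 -> R,
     forall u, J u = \sum_(a : 'I_9) \sum_(b : 'I_9 | (a < b)%N)
       c a b *: frame_endo g e (I a) (frame_endo g e (I b) u)].

(* Main.v *)
(* Torsion-freeness of the Levi-Civita connection gives
   T*(X, Y) = Gamma(Y) X - Gamma(X) Y, so it suffices to prove the identity for
   A(X, Y) = Gamma(X) Y in place of T*.  In a frame, A(X, Y) = 6 O(Y X^T) G, where
   O(Z) is the sum over a < b < d of K Z K^T, K = I_a I_b I_d.  With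
   S(Z) = \sum_a I_a Z I_a one has 6 O = S^3 + (2 - 3 * 9) S, and S commutes with
   ad_J for J in spin(9); hence so does O.  If moreover J^2 = -1, then
   ad_J^2 Z = -2 (Z + J Z J), so O(J Z J) = J O(Z) J, and the identity follows. *)
From HB Require Import structures.
Require Import Defs.
From mathcomp Require Import all_boot all_order all_algebra.
From mathcomp Require Import all_classical all_reals all_analysis.
From mathcomp Require Import zify.
Import Order.TTheory GRing.Theory Num.Theory numFieldNormedType.Exports.
Local Open Scope classical_set_scope.
Local Open Scope ring_scope.
Set Implicit Arguments.
Unset Strict Implicit.
Unset Printing Implicit Defensive.

(** * Counting triples of indices *)

(** Pointwise, 1 + 2[a = b = d] is the number of strict orders and of pairwise equalities satisfied
    by (a, b, d). By the symmetry of [F] the six orders contribute equal sums; each of the three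
    equalities contributes [n] times the sum of [f]. *)
Lemma sum_increasing_triples (n : nat) (V : zmodType)
    (F : 'I_n -> 'I_n -> 'I_n -> V) (f : 'I_n -> V) :
  (forall a b d, F a b d = F b a d) -> (forall a b d, F a b d = F a d b) ->
  (forall a b, F a a b = f b) ->
  \sum_a \sum_b \sum_d F a b d + (\sum_a f a) *+ 2 =
  (\sum_(a : 'I_n) \sum_(b : 'I_n | (a < b)%N) \sum_(d : 'I_n | (b < d)%N)
     F a b d) *+ 6 + (\sum_a f a) *+ (3 * n).
Proof.
move=> F12 F23 Ff; set E := (X in X *+ 6).
(* Weighting each triple by a multiplicity [P] reduces the claim to an identity between natural
   numbers. *)
pose S (P : 'I_n -> 'I_n -> 'I_n -> nat) :=
  \sum_a \sum_b \sum_d F a b d *+ P a b d.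
have SD P Q : S (fun a b d => P a b d + Q a b d)%N = S P + S Q.
  rewrite /S -big_split; apply: eq_bigr => a _ /=.
  rewrite -big_split; apply: eq_bigr => b _ /=.
  by rewrite -big_split; apply: eq_bigr => d _; rewrite mulrnDr.
have S12 P : S (fun a b d => P b a d) = S P.
  rewrite /S exchange_big; apply: eq_bigr => a _; apply: eq_bigr => b _.
  by apply: eq_bigr => d _; rewrite F12.
have S23 P : S (fun a b d => P a d b) = S P.
  rewrite /S; apply: eq_bigr => a _; rewrite exchange_big.
  apply: eq_bigr => b _.
  by apply: eq_bigr => d _; rewrite F23.
have SE : S (fun a b d => (a < b < d)%N) = E.
  apply: eq_bigr => a _; rewrite [RHS]big_mkcond; apply: eq_bigr => b _ /=.
  case: ltnP => ab /=; last by rewrite big1.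
  by rewrite [RHS]big_mkcond; apply: eq_bigr => d _; case: ltnP.
have Sdiag : S (fun a b d => (a == b)) = (\sum_a f a) *+ n.
  rewrite -[X in _ *+ X]card_ord -sumr_const; apply: eq_bigr => a _.
  rewrite (bigD1 a)//= eqxx [X in _ + X]big1 ?addr0 => [|b].
    by apply: eq_bigr => d _; rewrite Ff.
  by rewrite eq_sym => /negbTE ->; rewrite big1.
have Sdiag2 : S (fun a b d => ((a == b) && (b == d)).*2) = (\sum_a f a) *+ 2.
  rewrite -sumrMnl; apply: eq_bigr => a _.
  rewrite (bigD1 a)//= [X in _ + X]big1 ?addr0 => [|b]; last first.
    by rewrite eq_sym => /negbTE ->; rewrite big1.
  rewrite (bigD1 a)//= [X in _ + X]big1 ?addr0 => [|b]; last first.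
    by rewrite eq_sym => /negbTE ->; rewrite andbF.
  by rewrite eqxx Ff.
have S1 : \sum_a \sum_b \sum_d F a b d = S (fun _ _ _ => 1%N) by [].
rewrite S1 -Sdiag2 -SD.
transitivity (S (fun a b d =>
  (a < b < d) + (b < a < d) + (a < d < b) + (b < d < a) + (d < a < b)
  + (d < b < a) + ((a == b) + (a == d) + (b == d)))%N).
  apply: eq_bigr => a _; apply: eq_bigr => b _; apply: eq_bigr => d _.
  congr (_ *+ _); rewrite -!(inj_eq val_inj) /=; lia.
have E2 := S12 (fun a b d => (a < b < d)%N).
have E3 := S23 (fun a b d => (a < b < d)%N).
have E4 := S12 (fun a b d => (a < d < b)%N).
have E5 := S23 (fun a b d => (b < a < d)%N).
have E6 := S12 (fun a b d => (d < a < b)%N).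
have D2 := S23 (fun a b d => (a == b) : nat).
have D3 := S12 (fun a b d => (a == d) : nat).
rewrite !SD E6 E5 E4 E3 E2 SE D3 D2 Sdiag.
by rewrite mulnC mulrnA !mulrSr !mulr0n !add0r.
Qed.

(** * Operators commuting with ad_J *)

Definition ad_equivariant (A : pzRingType) (J : A) (T : A -> A) : Prop :=
  forall Z, T (J * Z - Z * J) = J * T Z - T Z * J.

Lemma ad_equivariant_comp (A : pzRingType) (J : A) (T S : A -> A) :
  ad_equivariant J T -> ad_equivariant J S -> ad_equivariant J (T \o S).
Proof. by move=> hT hS Z /=; rewrite hS hT. Qed.

Lemma ad_equivariant_conj (R : numFieldType) (A : algType R) (J : A)
    (T : {additive A -> A}) :
  ad_equivariant J T -> J * J = -1 -> forall Z, T (J * Z * J) = J * T Z * J.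
Proof.
move=> hT hJ Z.
have adJ2 W : J * (J * W - W * J) - (J * W - W * J) * J =
    - ((W + J * W * J) *+ 2).
  rewrite mulrBr mulrBl !mulrA hJ -(mulrA W) hJ mulrN1 mulN1r.
  by rewrite opprB mulr2n !opprD.
have /eqP := hT (J * Z - Z * J).
rewrite adJ2 hT adJ2 (raddfN T) (raddfMn T) (raddfD T).
(* The common factor 2 coming from ad_J^2 is cancelled in characteristic zero. *)
rewrite eqr_opp -subr_eq0 -mulrnBl -scaler_nat scaler_eq0 pnatr_eq0 /=.
by rewrite subr_eq0 => /eqP /addrI.
Qed.

(** By [ad_equivariant_conj] the first term is -J T(Z) J. Equivariance gives T(J Z) - T(Z J) = J
    T(Z) - T(Z) J, and J times this is -T(Z) - J T(Z) J, so everything cancels. *)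
Lemma ad_equivariant_nijenhuis (R : numFieldType) (A : algType R) (J : A)
    (T : {additive A -> A}) :
  ad_equivariant J T -> J * J = -1 ->
  forall Z, - T (J * Z * J) + J * T (Z * J) - J * T (J * Z) - T Z = 0.
Proof.
move=> hT hJ Z; rewrite (ad_equivariant_conj hT hJ).
have := hT Z; rewrite (raddfB T) => /eqP; rewrite subr_eq => /eqP ->.
rewrite !mulrDr mulrN !mulrA hJ mulN1r opprD opprD !opprK.
by rewrite addrACA subrr addr0 [T Z + _]addrC addKr subrr.
Qed.

(** * Clifford relations and sandwich operators *)

Definition clifford (A : pzRingType) (n : nat) (I : 'I_n -> A) : Prop :=
  (forall a, I a * I a = 1) /\
  (forall a b, a != b -> I a * I b = - (I b * I a)).

Definition sandwich (A : pzRingType) (n : nat) (I : 'I_n -> A) (Z : A) : A :=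
  \sum_a I a * Z * I a.

(** The operator O of the overview. The right factor is the reversed product, which is the transpose
    of the left one when the [I a] are symmetric matrices. *)
Definition triple_sandwich (A : pzRingType) (n : nat) (I : 'I_n -> A) (Z : A) :
    A :=
  \sum_(a : 'I_n) \sum_(b : 'I_n | (a < b)%N) \sum_(d : 'I_n | (b < d)%N)
    I a * I b * I d * Z * (I d * I b * I a).

Lemma sandwich_is_linear (R : comPzRingType) (A : algType R) (n : nat)
    (I : 'I_n -> A) : linear (sandwich I).
Proof.
move=> c Y Z; rewrite /sandwich scaler_sumr -big_split.
apply: eq_bigr => a _ /=.
by rewrite mulrDr mulrDl -scalerAr -scalerAl.
Qed.
HB.instance Definition _ (R : comPzRingType) (A : algType R) (n : nat)
    (I : 'I_n -> A) :=
  GRing.isLinear.Build R A A *:%R (sandwich I) (sandwich_is_linear I).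

(** Linearity in J reduces to J = I_p I_q with p < q. The defect of equivariance is the sum over a
    of D_a Z I_a + I_a Z D_a, where D_a = [I_a, J] vanishes except for D_p = 2 I_q and D_q = -2 I_p;
    these two contributions cancel. *)
Lemma sandwich_ad_equivariant (R : comPzRingType) (A : algType R) (n : nat)
    (I : 'I_n -> A) (c : 'I_n -> 'I_n -> R) :
  clifford I ->
  ad_equivariant
    (\sum_(a : 'I_n) \sum_(b : 'I_n | (a < b)%N) c a b *: (I a * I b))
    (sandwich I).
Proof.
move=> [I2 IN].
pose ok J := ad_equivariant J (sandwich I).
have ok0 : ok 0 by move=> Z; rewrite !mul0r !mulr0 subrr linear0.
have okD J K : ok J -> ok K -> ok (J + K).
  move=> hJ hK Z; rewrite !mulrDl !mulrDr !opprD addrACA linearD /= hJ hK.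
  exact: addrACA.
have okZ k J : ok J -> ok (k *: J).
  by move=> hJ Z; rewrite -!scalerAl -!scalerAr -!scalerBr linearZ_LR /= hJ.
apply: (big_ind ok) => // p _; apply: (big_ind ok) => // q pq; apply: okZ => Z.
have {}pq : p != q by rewrite neq_ltn pq.
set J := I p * I q; pose D a := I a * J - J * I a.
have commJ a : I a * (J * Z - Z * J) * I a
    - (J * (I a * Z * I a) - I a * Z * I a * J) = D a * Z * I a + I a * Z * D a.
  by rewrite !mulrBr !mulrBl !mulrA opprD opprK addrACA [- _ + _]addrC.
have Dp : D p = I q *+ 2.
  by rewrite /D /J mulrA I2 mul1r (IN p q)// mulNr opprK -mulrA I2 mulr1.
have Dq : D q = - (I p *+ 2).
  rewrite /D /J -[_ * _ * I q]mulrA I2 mulr1 (IN p q)// mulrN mulrA I2 mul1r.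
  by rewrite -opprD.
have D0 a : a != p -> a != q -> D a = 0.
  move=> ap aq; apply/eqP; rewrite subr_eq0 /J mulrA (IN a p)// mulNr.
  by rewrite -mulrA (IN a q)// mulrN opprK mulrA.
rewrite /sandwich mulr_sumr mulr_suml -sumrB; apply/eqP.
rewrite -subr_eq0 -sumrB (bigD1 p)//= (bigD1 q) 1?eq_sym//=.
rewrite [X in _ + (_ + X)]big1.
  rewrite addr0 !commJ Dp Dq !(mulNr, mulrN, mulrnAl, mulrnAr).
  by rewrite [_ + I p * Z * I q *+ 2]addrC -opprD subrr.
by move=> a /andP[ap aq]; rewrite commJ D0// mul0r mul0r mulr0 addr0.
Qed.

(** The cube of [sandwich I] is the same sum over all triples. Its summand is symmetric in the
    indices, since a transposition changes the sign on both sides of Z, and two equal adjacent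
    indices cancel to leave I_d Z I_d; so [sum_increasing_triples] applies. *)
Lemma triple_sandwichE (A : nzRingType) (n : nat) (I : 'I_n -> A) (Z : A) :
  clifford I ->
  triple_sandwich I Z *+ 6 =
  sandwich I (sandwich I (sandwich I Z)) + sandwich I Z *+ 2
  - sandwich I Z *+ (3 * n).
Proof.
move=> [I2 IN]; have swap a b W :
    I a * I b * W * (I b * I a) = I b * I a * W * (I a * I b).
  have [->//|ab] := eqVneq a b.
  by rewrite (IN a b)// !mulNr mulrN.
rewrite [in LHS]/triple_sandwich.
apply: (addIr (sandwich I Z *+ (3 * n))); rewrite subrK.
rewrite -(@sum_increasing_triples n A
  (fun a b d => I a * I b * I d * Z * (I d * I b * I a))
  (fun d => I d * Z * I d)).
- congr (_ + _); rewrite /sandwich; apply: eq_bigr => a _.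
  rewrite mulr_sumr mulr_suml; apply: eq_bigr => b _.
  rewrite mulr_sumr mulr_suml mulr_sumr mulr_suml; apply: eq_bigr => d _.
  by rewrite !mulrA.
- move=> a b d.
  by have := swap a b (I d * Z * I d); rewrite !mulrA.
- move=> a b d.
  have := swap b d Z => /(congr1 (fun W => I a * W * I a)).
  by rewrite !mulrA.
- move=> a b; rewrite I2 mul1r -[I b * I a * I a]mulrA I2 mulr1 //.
Qed.

Lemma triple_sandwich_is_linear (R : comPzRingType) (A : algType R) (n : nat)
    (I : 'I_n -> A) : linear (triple_sandwich I).
Proof.
move=> c Y Z; rewrite /triple_sandwich.
do 3 (rewrite scaler_sumr -big_split; apply: eq_bigr => ? _ /=).
by rewrite mulrDr mulrDl -scalerAr -scalerAl.
Qed.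
HB.instance Definition _ (R : comPzRingType) (A : algType R) (n : nat)
    (I : 'I_n -> A) :=
  GRing.isLinear.Build R A A *:%R (triple_sandwich I)
    (triple_sandwich_is_linear I).

Lemma triple_sandwich_ad_equivariant (R : numFieldType) (A : algType R) (n : nat)
    (I : 'I_n -> A) (c : 'I_n -> 'I_n -> R) :
  clifford I ->
  ad_equivariant
    (\sum_(a : 'I_n) \sum_(b : 'I_n | (a < b)%N) c a b *: (I a * I b))
    (triple_sandwich I).
Proof.
move=> hI; set J := \sum_a _.
have hS : ad_equivariant J (sandwich I) := sandwich_ad_equivariant c hI.
have hS3 : ad_equivariant J (fun Z => sandwich I (sandwich I (sandwich I Z))) :=
  ad_equivariant_comp hS (ad_equivariant_comp hS hS).
(* After scaling by 6 the operator is a polynomial in [sandwich I]. *)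
move=> Z; apply: (@scalerI R A 6%:R); first by rewrite pnatr_eq0.
rewrite scalerBr scalerAr scalerAl !scaler_nat !triple_sandwichE//.
rewrite hS3 hS !(mulrBr, mulrBl, mulrDr, mulrDl) !mulrnBl !mulrnAr !mulrnAl.
by rewrite !opprD !opprK -!mulr2n (addrACA (J * _)) [LHS]addrACA.
Qed.

(** With Z = Y X^T and J^T = -J, replacing X by J X turns Z into -Z J, and replacing Y by J Y turns
    Z into J Z; this produces the four terms of [ad_equivariant_nijenhuis]. *)
Lemma triple_sandwich_nijenhuis (R : numFieldType) (n m : nat)
    (I : 'I_n -> 'M[R]_m.+1) (c : 'I_n -> 'I_n -> R)
    (J := \sum_(a : 'I_n) \sum_(b : 'I_n | (a < b)%N) c a b *: (I a *m I b))
    (B := fun X Y G : 'cV[R]_m.+1 => triple_sandwich I (Y *m X^T) *m G) :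
  clifford I -> (forall a, (I a)^T = I a) -> J *m J = - 1%:M ->
  forall X Y G,
    B (J *m X) (J *m Y) G - J *m B (J *m X) Y G - J *m B X (J *m Y) G - B X Y G = 0.
Proof.
move=> hI It J2 X Y G.
(* Transposition reverses each product I_a I_b, and a < b makes the factors anticommute. *)
have Jt : J^T = - J.
  rewrite /J linear_sum -sumrN; apply: eq_bigr => a _ /=.
  rewrite linear_sum -sumrN; apply: eq_bigr => b ab /=.
  have /hI.2 hab : a != b by rewrite neq_ltn ab.
  by rewrite linearZ /= trmx_mul !It -scalerN -!mulmxE in hab *; rewrite hab opprK.
have := ad_equivariant_nijenhuis (J := J) (T := triple_sandwich I)
  (triple_sandwich_ad_equivariant c hI) J2 (Y *m X^T).
move=> /(congr1 (mulmx^~ G)); rewrite mul0mx => <-.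
rewrite /B !trmx_mul Jt !mulmxN !mulmxA !(raddfN (triple_sandwich I)).
by rewrite /= !mulmxBl mulmxDl -!mulmxE !mulmxN !mulNmx opprK !mulmxA.
Qed.

(* The order of the subtrahends differs in the two hypotheses because this
   antisymmetrizes a bilinear identity. *)
Lemma additive_subr4 (U V : zmodType) (f : {additive U -> V})
    (p q r s p' q' r' s' : U) :
  p - r - q - s = 0 -> p' - q' - r' - s' = 0 ->
  f (p - p') - f (q - q') - f (r - r') - f (s - s') = 0.
Proof.
have subrACA (a b c d : U) : (a - b) - (c - d) = (a - c) - (b - d).
  by rewrite !opprD addrACA.
move=> h h'; rewrite -3!(raddfB f) (subrACA p) (subrACA (p - q)).
by rewrite (subrACA (p - q - r)) [p - q - r]addrAC h h' subrr raddf0.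
Qed.

(** * Functions of class C^k on open sets *)

(** Directional derivatives depend only on germs, and functions that agree on an open set have equal
    germs at its points. *)
Lemma is_Ck_ext (R : realType) (n k : nat) (U : set 'rV[R]_n)
    (f g : 'rV[R]_n -> R) :
  open U -> (forall p, U p -> f p = g p) -> is_Ck k U f -> is_Ck k U g.
Proof.
move=> oU; elim: k f g => [|k IH] f g fg.
  move=> cf p Up; have nfg : {near p, f =1 g}.
    by apply: filterS (open_nbhs_nbhs (conj oU Up)).
  rewrite /prop_for /continuous_at -(fg p Up).
  apply: cvg_trans; last exact: (cf p Up).
  exact: (near_eq_cvg nfg).
move=> /= hf i; have [df Cf] := hf i.
have nfg p : U p -> {near p, f =1 g}.
  by move=> Up; apply: filterS (open_nbhs_nbhs (conj oU Up)).
split=> [p Up|]; first exact: near_eq_derivable (nfg p Up) (df p Up).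
by apply: IH Cf => p Up; apply: near_eq_derive; exact: nfg.
Qed.

Lemma is_Ck_cst (R : realType) (n k : nat) (U : set 'rV[R]_n) (a : R) :
  is_Ck k U (cst a : 'rV[R]_n -> R).
Proof.
elim: k a => [|k IH] a /=; first by move=> p _; exact: cst_continuous.
move=> i; split=> [p _|]; first exact: derivable_cst.
rewrite (_ : (fun p => _) = cst 0); first exact: IH.
by apply/funext => p; rewrite derive_cst.
Qed.

Lemma is_Ck_linear (R : realType) (n k : nat) (U : set 'rV[R]_n) (a : R)
    (f g : 'rV[R]_n -> R) :
  open U -> is_Ck k U f -> is_Ck k U g -> is_Ck k U (fun p => a * f p + g p).
Proof.
move=> oU; elim: k f g => [|k IH] f g.
  move=> cf cg p Up; apply: continuousD (cg p Up).
  by apply: continuousM (cf p Up); exact: cst_continuous.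
move=> /= hf hg i; have [df Cf] := hf i; have [dg Cg] := hg i.
have dZf p : U p -> derivable (a \*: f) p (delta_mx 0 i).
  by move=> Up; apply: derivableZ; exact: df.
split=> [p Up|]; first exact: (derivableD (dZf p Up) (dg p Up)).
apply: (is_Ck_ext oU _ (IH _ _ Cf Cg)) => p Up.
rewrite -[RHS]/('D_(delta_mx 0 i) (a \*: f + g) p) deriveD ?deriveZ//.
- exact: df.
- exact: dZf.
- exact: dg.
Qed.

(** * Tangent vectors and covariant derivatives of constant combinations of fields *)

Section Smooth.
Context (R : realType) (n : nat) (M : manifold R n).

Lemma cmap_image_open (c : chart R n M) (V : set M) :
  open V -> open (cmap c @` (V `&` cdom c)).
Proof.
move=> oV.
rewrite (_ : _ @` _ = (cmap c @` cdom c) `&` (cinv c @^-1` V)); last first.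
  apply/seteqP; split=> [_ [y [Vy cy] <-]|_ [[y cy <-]]] /=.
    by split; [exists y|rewrite cmapK].
  by rewrite cmapK// => Vy; exists y.
rewrite openE => p [cp Vp]; apply: filterI.
  by apply: open_nbhs_nbhs; split=> //; exact: cimg_open.
by apply: (cinv_continuous cp); apply: open_nbhs_nbhs.
Qed.

Lemma smooth_on_cst (V : set M) (a : R) : smooth_on V (fun=> a).
Proof. by move=> c _ k; exact: is_Ck_cst. Qed.

Lemma smooth_on_linear (V : set M) (a : R) (f g : M -> R) :
  open V -> smooth_on V f -> smooth_on V g ->
  smooth_on V (fun y => a * f y + g y).
Proof.
move=> oV sf sg c ac k.
by apply: is_Ck_linear (sf c ac k) (sg c ac k); exact: cmap_image_open.
Qed.

Lemma tangentZDE (x : M) (a : R) (u v : tangent x) (f : M -> R) :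
  (a *: u + v) f = a * u f + v f.
Proof. by []. Qed.

Lemma tangentP (x : M) (u : tangent x) : derivations x u.
Proof. by have := tangent_proof u; rewrite inE. Qed.

Lemma smooth_at_cst (x : M) (a : R) : smooth_at x (fun=> a).
Proof.
by exists setT; [split=> //; exact: openT|exact: smooth_on_cst].
Qed.

(** The Leibniz rule for 1 = 1 * 1 kills the constant 1. The general case follows by linearity,
    writing the constants as 0 = (-1) * 1 + 1 and a = a * 1 + 0. *)
Lemma tangent_cst (x : M) (u : tangent x) (a : R) : u (fun=> a) = 0.
Proof.
have [uD uM _ _] := tangentP u.
have s := smooth_at_cst x.
have u1 : u (fun=> 1) = 0.
  have := uM _ _ (s 1) (s 1); rewrite !mulr1 mul1r => /eqP.
  by rewrite -subr_eq0 opprD addrA subrr add0r oppr_eq0 => /eqP.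
have u0 : u (fun=> 0) = 0.
  have := uD (-1) _ _ (s 1) (s 1).
  by rewrite u1 mulr0 addr0 !mulr1 addNr.
have := uD a _ _ (s 1) (s 0).
by rewrite u1 u0 mulr0 addr0 mulr1 addr0.
Qed.

Lemma smooth_vf_sum (U : set M) (m : nat) (v : 'I_m -> R)
    (E : 'I_m -> forall y : M, tangent y) :
  (forall j, smooth_vf U (E j)) -> smooth_vf U (fun y => \sum_j v j *: E j y).
Proof.
move=> sE; elim: m v E sE => [|m IH] v E sE.
  move=> V f oV VU sf; under eq_fun do rewrite big_ord0.
  exact: smooth_on_cst.
move=> V f oV VU sf; under eq_fun do rewrite big_ord_recl tangentZDE.
apply: smooth_on_linear => //; first exact: sE.
by apply: IH => // j; exact: sE.
Qed.

(** Constant coefficients have zero derivative, so the Leibniz rule leaves only the derivatives of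
    the [E j]. *)
Lemma cov_sum (nabla : connection M) (U : set M) (x : M) (m : nat)
    (v : 'I_m -> R) (E : 'I_m -> forall y : M, tangent y) (u : tangent x) :
  open_nbhs x U -> (forall j, smooth_vf U (E j)) ->
  nabla x u (fun y => \sum_j v j *: E j y) = \sum_j v j *: nabla x u (E j).
Proof.
move=> oU; elim: m v E => [|m IH] v E sE.
  (* The zero field satisfies z = z + z, so additivity and locality force its derivative to
     vanish. *)
  rewrite big_ord0; have s0 := smooth_vf_sum v sE; set z := fun y => _ in s0 *.
  have zz y : U y -> z y = z y + z y by rewrite /z !big_ord0 addr0.
  have /eqP := cov_add nabla oU s0 s0 u.
  rewrite -(cov_local nabla oU s0 zz) -subr_eq0 opprD addrA subrr add0r oppr_eq0.
  by move/eqP.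
have sE' j := sE (lift ord0 j).
rewrite (cov_local nabla oU (smooth_vf_sum v sE)
  (Z := fun y => v ord0 *: E ord0 y + \sum_j v (lift ord0 j) *: E (lift ord0 j) y));
  last by move=> y _; rewrite big_ord_recl.
rewrite big_ord_recl (cov_add nabla oU) ?IH//; last first.
- exact: smooth_vf_sum.
(* Smoothness of a constant multiple is that of a one-term sum. *)
- have := smooth_vf_sum (fun=> v ord0) (fun _ : 'I_1 => sE ord0).
  by under [X in smooth_vf _ X]functional_extensionality_dep do rewrite big_ord1.
rewrite (cov_leibniz nabla oU (smooth_on_cst _ _) (sE ord0)).
by rewrite tangent_cst scale0r add0r.
Qed.
End Smooth.

(** * Coordinates in orthonormal frames *)

Lemma frame_map_is_linear (R : realType) (n : nat) (M : manifold R n) (x : M)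
    (e : frame x) : linear (frame_map e).
Proof.
move=> a v w; rewrite /frame_map scaler_sumr -big_split; apply: eq_bigr => i _ /=.
by rewrite !mxE scalerDl scalerA.
Qed.
HB.instance Definition _ (R : realType) (n : nat) (M : manifold R n) (x : M)
    (e : frame x) :=
  GRing.isLinear.Build R 'cV[R]_n (tangent x) *:%R (frame_map e)
    (frame_map_is_linear e).

Section Frames.
Context (R : realType) (n : nat) (M : manifold R n) (g : metric M).

Lemma metric_frame_mapl (x : M) (e : frame x) (v : 'cV[R]_n) (w : tangent x) :
  g x (frame_map e v) w = \sum_i v i 0 * g x (e i) w.
Proof.
have g0 : g x 0 w = 0.
  have := metric_lin g 1 0 0 w; rewrite scale1r addr0 mul1r => /eqP.
  by rewrite -subr_eq0 opprD addrA subrr add0r oppr_eq0 => /eqP.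
have gD u u' : g x (u + u') w = g x u w + g x u' w.
  by rewrite -[u in LHS]scale1r metric_lin mul1r.
have gZ a u : g x (a *: u) w = a * g x u w.
  by rewrite -[a *: u]addr0 metric_lin g0 addr0.
rewrite /frame_map (big_morph (fun u => g x u w) gD g0).
by apply: eq_bigr => i _; rewrite gZ.
Qed.

Context (x : M) (e : frame x) (eO : Defs.orthonormal g e).

Lemma frame_coords (v : 'cV[R]_n) : \col_j g x (frame_map e v) (e j) = v.
Proof.
apply/matrixP => j k; rewrite ord1 mxE metric_frame_mapl (bigD1 j)//= big1.
  by rewrite eO eqxx mulr1 addr0.
by move=> i /negbTE ij; rewrite eO ij mulr0.
Qed.

Lemma metric_frame_map (v w : 'cV[R]_n) :
  g x (frame_map e v) (frame_map e w) = (v^T *m w) 0 0.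
Proof.
rewrite metric_frame_mapl mxE; apply: eq_bigr => i _.
rewrite mxE Defs.metric_sym; congr (_ * _).
by have /matrixP/(_ i 0) := frame_coords w; rewrite mxE.
Qed.

Lemma frame_endo_map (A : 'M[R]_n) (v : 'cV[R]_n) :
  frame_endo g e A (frame_map e v) = frame_map e (A *m v).
Proof. by rewrite /frame_endo frame_coords. Qed.

End Frames.

(** Since [w] is constant, only the frame is differentiated, and column j of the connection form
    holds the coordinates of the derivative of s_j. *)
Lemma cov_frame_map (R : realType) (n : nat) (M : manifold R n) (g : metric M)
    (nabla : connection M) (U : set M) (s : forall y : M, frame y) (x : M)
    (u : tangent x) (w : 'cV[R]_n) :
  open_nbhs x U -> (forall j, smooth_vf U (fun y => s y j)) ->
  SO_frame g (s x) ->
  nabla x u (fun y => frame_map (s y) w) =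
  frame_map (s x) (connection_form g nabla s u *m w).
Proof.
move=> oU sU [[coord _ mapK] eO _].
rewrite (cov_sum nabla (fun j => w j 0) u oU sU).
have expand v : v = frame_map (s x) (\col_i g x v (s x i)).
  by rewrite -{1 2}[v]mapK frame_coords.
transitivity (\sum_j w j 0 *:
    frame_map (s x) (col j (connection_form g nabla s u))).
  apply: eq_bigr => j _; rewrite [in LHS](expand (nabla x u _)).
  by congr (_ *: frame_map _ _); apply/matrixP => i k; rewrite !mxE.
rewrite -(eq_bigr _ (fun j _ => linearZ_LR _ _ _)) -linear_sum; congr frame_map.
apply/matrixP => i k; rewrite ord1 summxE mxE; apply: eq_bigr => j _.
by rewrite !mxE mulrC.
Qed.

(** * Torsion of the connection Z* *)

(** On fields with constant coordinates in a section of [P], [Gamma] is the difference of [nabla]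
    and [nabla_star]. Subtracting the vanishing torsion of [nabla] cancels the Lie brackets. *)
Lemma torsion_tensorE (R : realType) (I : 'I_9 -> 'M[R]_16)
    (M : manifold R 16) (g : metric M) (P : spin9_structure g I)
    (nabla nabla_star : connection M)
    (Gamma : forall x : M, tangent x -> tangent x -> tangent x)
    (Tstar : forall x : M, tangent x -> tangent x -> tangent x) :
  is_levi_civita g nabla -> spin9_decomposition P nabla nabla_star Gamma ->
  is_torsion_tensor nabla_star Tstar ->
  forall (x : M) (X Y : tangent x), Tstar x X Y = Gamma x Y X - Gamma x X Y.
Proof.
move=> [tf _] hdec hT x.
have [U [s [oU sec]]] := reduction_section P x.
have [_ sU sP] := sec; have SOs := reduction_SO (sP x oU.2).
have GammaE u w : Gamma x u (frame_map (s x) w) =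
    nabla x u (fun y => frame_map (s y) w)
    - nabla_star x u (fun y => frame_map (s y) w).
  have [_ [B _ [ZB ->]]] := hdec U s sec x u oU.2.
  rewrite !(cov_frame_map _ _ _ oU sU SOs) ZB mulmxDl raddfD /= addrC addKr.
  by case: SOs => _ eO _; rewrite frame_endo_map.
have [[coord _ mapK] eO _] := SOs.
(* Both vectors are extended near [x] with constant coordinates in [s]. *)
move=> X Y; rewrite -[X]mapK -[Y]mapK.
set v := coord X; set w := coord Y.
have sf a : smooth_vf U (fun y => frame_map (s y) a) by exact: smooth_vf_sum.
apply: etrans (hT U _ _ x oU (sf v) (sf w)) _.
rewrite -[LHS]subr0 -(tf U _ _ x oU (sf v) (sf w)) /torsion !GammaE.
set a := nabla_star _ _ _; set b := nabla_star _ _ _.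
set a' := nabla _ _ _; set b' := nabla _ _ _; set L := lie_bracket _ _ _.
rewrite opprB addrA subrK !opprB addrACA [RHS]addrC [RHS]addrACA.
by congr (_ + _); rewrite addrC.
Qed.

(** * The identity in an adapted frame *)

Theorem proposition2 (R : realType)
  (I : 'I_9 -> 'M[R]_16) (hI : spin9_involutions I)
  (M : manifold R 16) (hM : oriented_atlas M) (g : metric M)
  (P : spin9_structure g I)
  (nabla : connection M) (hnabla : is_levi_civita g nabla)
  (nabla_star : connection M)
  (Gamma : forall x : M, tangent x -> tangent x -> tangent x)
  (hdec : spin9_decomposition P nabla nabla_star Gamma)
  (hP : nearly_parallel P Gamma)
  (Tstar : forall x : M, tangent x -> tangent x -> tangent x)
  (hT : is_torsion_tensor nabla_star Tstar)
  (x : M) (J : tangent x -> tangent x) (hJ : Lambda2V P J)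
  (hJ2 : forall u, J (J u) = - u) (X Y : tangent x) :
  Tstar x (J X) (J Y) - J (Tstar x (J X) Y) - J (Tstar x X (J Y)) - Tstar x X Y
  = 0.
Proof.
(* The frame that exhibits [J] also serves to expand [Gamma], so that both are expressed through the
   same matrices [I a]. *)
have [e Pe [c Jc]] := hJ.
have [[coord frameK coordK] eO _] := reduction_SO Pe.
have [I2 It IN] := hI; have hcl : clifford I by [].
have [Gv _ hG] := hP; rewrite !(torsion_tensorE hnabla hdec hT).
pose Jm := \sum_(a : 'I_9) \sum_(b : 'I_9 | (a < b)%N) c a b *: (I a *m I b).
have JE v : J (frame_map e v) = frame_map e (Jm *m v).
  rewrite Jc /Jm mulmx_suml linear_sum; apply: eq_bigr => a _ /=.
  rewrite mulmx_suml linear_sum; apply: eq_bigr => b _ /=.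
  by rewrite !frame_endo_map// -scalemxAl linearZ mulmxA.
(* Injectivity of [frame_map e] turns the relation on each frame vector into equality of a matrix
   column. *)
have Jm2 : Jm *m Jm = - 1%:M.
  apply/matrixP => i j.
  have /(congr1 coord) := hJ2 (frame_map e (delta_mx j 0)).
  rewrite !JE -raddfN !frameK mulmxA => /matrixP/(_ i 0).
  by rewrite -colE mxE => ->; rewrite !mxE eqxx andbT.
pose B (v w : 'cV[R]_16) := 6%:R *: (triple_sandwich I (w *m v^T) *m coord (Gv x)).
have GammaE v w : Gamma x (frame_map e v) (frame_map e w) =
    frame_map e (B v w).
  rewrite (hG x e Pe) /B linearZ /= /triple_sandwich; congr (_ *: _).
  rewrite mulmx_suml linear_sum; apply: eq_bigr => a _ /=.
  rewrite mulmx_suml linear_sum; apply: eq_bigr => b _ /=.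
  rewrite mulmx_suml linear_sum; apply: eq_bigr => d _ /=.
  rewrite -[Gv x]coordK frameK !frame_endo_map// metric_frame_map// -linearZ.
  congr frame_map; rewrite -!mulmxE !mulmxA -3![in RHS]mulmxA.
  (* The scalar v^T u is read as a 1 x 1 matrix multiplying w on the right, so that w (v^T u)
     regroups as (w v^T) u. *)
  have -> (u : 'cV[R]_16) : (u^T *m v) 0 0 = (v^T *m u) 0 0.
    by rewrite -[in LHS](trmxK v) -trmx_mul mxE.
  by rewrite -mul_mx_scalar -mx11_scalar !mulmxA.
have N v w : B (Jm *m v) (Jm *m w) - Jm *m B (Jm *m v) w - Jm *m B v (Jm *m w)
    - B v w = 0.
  rewrite /B -!scalemxAr -!scalerBr.
  by rewrite triple_sandwich_nijenhuis ?scaler0.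
have TE v w : Gamma x (frame_map e w) (frame_map e v)
    - Gamma x (frame_map e v) (frame_map e w) = frame_map e (B w v - B v w).
  by rewrite !GammaE linearB.
rewrite -[X]coordK -[Y]coordK !JE !TE !JE !mulmxBr; clearbody B Jm.
(* The torsion has coordinates B(Y, X) - B(X, Y), so [N] is used for both orders of the
   arguments. *)
by apply: (@additive_subr4 _ _ (frame_map e)); exact: N.
Qed.
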